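(* Let $s,t\in\mathbb N$, $d=\gcd(s,t)$, $m=\mathrm{lcm}(s,t)$. Let $\sigma$ be an $s$-core and $\tau$ a $t$-core with $\mathrm{core}_d(\sigma)=\mathrm{core}_d(\tau)$, and put $\ell_0=\max(\ell(\sigma),\ell(\tau))$. Then for each integer $i\ge\ell_0$ and each $0\le j<d$ there exist an $\frac sd$-core $\sigma^i_j$, a $\frac td$-core $\tau^i_j$ and a nonnegative integer $\ell^i_j$ such that for all integers $k\ge0$, $$N_{\sigma,\tau}(i+mk)=\prod_{j=0}^{d-1}N_{\sigma^i_j,\tau^i_j}\!\left(\ell^i_j+\tfrac md k\right).$$
   Context: A partition $\lambda=(a_1,\dots,a_\ell)$ is a weakly decreasing finite sequence of positive integers; $\ell(\lambda)=\ell$ is its length. For $t\in\mathbb N$, a $t$-core is a partition whose Young diagram has no hook of size $t$; $\mathcal C_t$ is the set of $t$-cores; $\mathrm{core}_t\lambda$ is obtained from $\lambda$ by successively removing rim hooks (border strips) of size $t$ until none remain. For positive integers $u,v$, a $u$-core $\alpha$, a $v$-core $\gamma$ and an integer $k\ge0$, $N_{\alpha,\gamma}(k)=\#\{\lambda\in\mathcal C_{\mathrm{lcm}(u,v)}:\mathrm{core}_u\lambda=\alpha,\ \mathrm{core}_v\lambda=\gamma,\ \ell(\lambda)\le k\}$. (On the left side $u=s$, $v=t$; on the right side $u=s/d$, $v=t/d$, so $\mathrm{lcm}(u,v)=m/d$.) *)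

(* Defs.v *)
From mathcomp Require Import all_boot.
From Stdlib Require Import ClassicalEpsilon Relation_Operators.

Set Implicit Arguments.
Unset Strict Implicit.
Unset Printing Implicit Defensive.

Definition is_partition (la : seq nat) : bool :=
  sorted geq la && all (fun x => 0 < x) la.

Definition plen (la : seq nat) : nat := size la.

Definition cell (la : seq nat) (c : nat * nat) : bool := c.2 < nth 0 la c.1.

Definition conjpart (la : seq nat) (j : nat) : nat := count (fun x => j < x) la.

Definition hook (la : seq nat) (i j : nat) : nat :=
  (nth 0 la i - j) + (conjpart la j - i) - 1.

Definition is_core (t : nat) (la : seq nat) : Prop :=
  is_partition la /\ forall i j, cell la (i, j) -> hook la i j <> t.

Definition skew (la mu : seq nat) (c : nat * nat) : bool := cell la c && ~~ cell mu c.

Definition adjacent (c d : nat * nat) : bool :=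
  ((c.1 == d.1) && ((d.2 == c.2.+1) || (c.2 == d.2.+1))) ||
  ((c.2 == d.2) && ((d.1 == c.1.+1) || (c.1 == d.1.+1))).

Definition rim_hook_removal (t : nat) (la mu : seq nat) : Prop :=
  [/\ is_partition mu,
      (forall c, cell mu c -> cell la c),
      sumn la = sumn mu + t,
      (forall c d, skew la mu c -> skew la mu d ->
         exists p : seq (nat * nat),
           [&& path adjacent c p, last c p == d & all (skew la mu) p]) &
      ~ (exists i j, [&& skew la mu (i, j), skew la mu (i.+1, j),
                        skew la mu (i, j.+1) & skew la mu (i.+1, j.+1)])].

Definition is_core_of (t : nat) (la al : seq nat) : Prop :=
  clos_refl_trans (seq nat) (rim_hook_removal t) la al /\
  ~ (exists mu, rim_hook_removal t al mu).

(* core_t la (well defined by the standard uniqueness theorem) *)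
Definition core (t : nat) (la : seq nat) : seq nat :=
  epsilon (inhabits [::]) (fun al => is_core_of t la al).

Definition fcard (P : seq nat -> Prop) : nat :=
  epsilon (inhabits 0)
    (fun n => exists s : seq (seq nat),
        [/\ uniq s, size s = n & forall x, x \in s <-> P x]).

Definition Ncount (u v : nat) (al ga : seq nat) (k : nat) : nat :=
  fcard (fun la => [/\ is_core (lcmn u v) la, core u la = al,
                       core v la = ga & plen la <= k]).

(* Main.v *)
(** Encode a partition of length at most [n] by its set of [n] beads
    [la_i + n - 1 - i].  Removing a rim hook of size [t] moves one bead down by
    [t], so [core t la] is determined by the number of beads in each residue
    class mod [t], and a [t]-core is a bead set closed under [x + t |-> x].
    With [d = gcd s t], the partition is split into the [d] bead sets
    [{y | y * d + j in X}]: closure under [lcm s t] and the residue counts mod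
    [s] and mod [t] become the same conditions for [lcm s t / d], [s / d] and
    [t / d] on each of them, independently.  The only link between the pieces
    is their sizes, which are fixed by the common [d]-core.  Replacing [n] by
    [n + N * d] prepends [N] beads to every piece and leaves the partitions
    they encode unchanged. *)
Require Import Defs.
From mathcomp Require Import all_boot zify.
From Stdlib Require Import ClassicalEpsilon Relation_Operators.

Set Implicit Arguments.
Unset Strict Implicit.
Unset Printing Implicit Defensive.

(** * Partitions as weakly decreasing row sequences *)

Lemma sorted_geq_mkseq (f : nat -> nat) n :
  (forall i, i.+1 < n -> f i.+1 <= f i) -> sorted geq (mkseq f n).
Proof.
move=> fle; apply/(sortedP 0) => i; rewrite size_mkseq => ltin.
by rewrite !nth_mkseq /= ?fle //; apply: ltnW.
Qed.

Lemma part_nth_le la i j :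
  is_partition la -> i <= j -> nth 0 la j <= nth 0 la i.
Proof.
move=> /andP[sla _] leij.
have [ltj|gej] := ltnP j (size la); last by rewrite nth_default.
have geqT : transitive geq by move=> x y z /= h1 h2; apply: leq_trans h2 h1.
have geqR : reflexive geq by move=> x /=.
apply: (sorted_leq_nth geqT geqR 0 sla) => //; rewrite inE //.
exact: leq_ltn_trans ltj.
Qed.

Lemma part_nth_gt0 la i : is_partition la -> (0 < nth 0 la i) = (i < size la).
Proof.
move=> /andP[_ /(all_nthP 0) pos]; have [/pos //|le] := ltnP i (size la).
by rewrite nth_default.
Qed.

(** Rows weakly decrease, so those longer than [j] form an initial segment, and counting them
    amounts to testing row [i]. *)
Lemma ltn_conjpart la i j :
  is_partition la -> (i < conjpart la j) = (j < nth 0 la i).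
Proof.
move=> /andP[sla _]; rewrite /conjpart.
elim: la i sla => [|x la IH] i /=; first by rewrite nth_nil.
have geqT : transitive geq by move=> a b c /= h1 h2; apply: leq_trans h2 h1.
move=> sla; have := sla; rewrite path_sortedE // => /andP[/allP lex sla'].
have [ltjx|lexj] := ltnP j x; first by case: i => //= i; rewrite add1n ltnS IH.
have -> : count (fun x0 => j < x0) la = 0.
  rewrite -(count_pred0 la); apply: eq_in_count => y /lex /=; lia.
case: i => [|i] /=; first by lia.
have [lti|gei] := ltnP i (size la); last by rewrite nth_default //; lia.
by have /lex := mem_nth 0 lti; rewrite /=; lia.
Qed.

Lemma part_ext la mu :
  is_partition la -> is_partition mu -> nth 0 la =1 nth 0 mu -> la = mu.
Proof.
move=> pla pmu e; apply: (@eq_from_nth _ 0) => [|i _]; last exact: e.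
have := part_nth_gt0 (size la) pmu; have := part_nth_gt0 (size mu) pla.
rewrite -e e.
have := part_nth_gt0 (size la) pla; have := part_nth_gt0 (size mu) pmu.
by rewrite -e !ltnn e; lia.
Qed.

Lemma nth_filter_pos s i :
  sorted geq s -> nth 0 [seq x <- s | 0 < x] i = nth 0 s i.
Proof.
elim: s i => [|x s IH] i //= sxs.
have geqT : transitive geq by move=> a b c /= h1 h2; apply: leq_trans h2 h1.
move: sxs; rewrite path_sortedE // => /andP[/allP lex ss].
case: x lex => [|x] lex /=; last by case: i => //= i; apply: IH.
have -> : [seq x <- s | 0 < x] = [::].
  by apply/eqP; rewrite -[_ == _]negbK -has_filter; apply/hasPn=> y /lex /=; lia.
case: i => [|i] //=.
have [lti|gei] := ltnP i (size s); last by rewrite [RHS]nth_default.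
by have /lex := mem_nth 0 lti; rewrite /=; lia.
Qed.

Definition mkpart n (f : nat -> nat) := [seq x <- mkseq f n | 0 < x].

Section MkPart.
Variables (n : nat) (f : nat -> nat).
Hypothesis fle : forall i, i.+1 < n -> f i.+1 <= f i.

Lemma mkpartP : is_partition (mkpart n f).
Proof.
rewrite /is_partition filter_all andbT sorted_filter ?sorted_geq_mkseq //.
by move=> a b c /= h1 h2; apply: leq_trans h2 h1.
Qed.

Lemma nth_mkpart i : nth 0 (mkpart n f) i = if i < n then f i else 0.
Proof.
rewrite nth_filter_pos ?sorted_geq_mkseq //.
by case: ltnP => h; [rewrite nth_mkseq | rewrite nth_default ?size_mkseq].
Qed.

Lemma size_mkpart : size (mkpart n f) <= n.
Proof. by rewrite size_filter -[X in _ <= X](size_mkseq f) count_size. Qed.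

End MkPart.

(** * Bead sets and their correspondence with partitions *)

(** Rows past the end read as 0 by the default of [nth], so when [n] exceeds the length the surplus
    beads fill the lowest positions. *)
Definition beta n (la : seq nat) : seq nat :=
  mkseq (fun i => nth 0 la i + (n - i.+1)) n.

Lemma size_beta n la : size (beta n la) = n.
Proof. exact: size_mkseq. Qed.

Lemma mem_beta n la x :
  reflect (exists2 i, i < n & x = nth 0 la i + (n - i.+1)) (x \in beta n la).
Proof.
rewrite /beta /mkseq; apply: (iffP mapP) => [[i]|[i ltin ->]].
  by rewrite mem_iota => /= h ->; exists i.
by exists i => //; rewrite mem_iota.
Qed.

Lemma sorted_beta n la : is_partition la -> sorted gtn (beta n la).
Proof.
move=> pla; apply/(sortedP 0) => i; rewrite size_beta => ltin.
rewrite !nth_mkseq //=; last exact: ltnW.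
have := part_nth_le pla (leqnSn i); lia.
Qed.

Lemma gtn_trans : transitive gtn.
Proof. by move=> x y z /= h1 h2; apply: ltn_trans h2 h1. Qed.

Lemma beta_uniq n la : is_partition la -> uniq (beta n la).
Proof.
move=> /(sorted_beta n); apply: sorted_uniq; first exact: gtn_trans.
by move=> x /=; rewrite ltnn.
Qed.

Lemma beta_inj n la mu :
  is_partition la -> is_partition mu -> size la <= n -> size mu <= n ->
  beta n la =i beta n mu -> la = mu.
Proof.
move=> pla pmu sla smu e.
have {}e : beta n la = beta n mu.
  apply: (irr_sorted_eq gtn_trans); rewrite ?sorted_beta //.
  by move=> x /=; rewrite ltnn.
apply: part_ext => // i.
have [ltin|lein] := ltnP i n; last by rewrite !nth_default // (leq_trans _ lein).
have := congr1 (nth 0 ^~ i) e; rewrite !nth_mkseq //; lia.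
Qed.

(** Inverse of [beta]: sort the beads decreasingly, subtract the staircase, drop the zero rows. *)
Definition part (X : seq nat) : seq nat :=
  mkpart (size X) (fun i => nth 0 (sort geq X) i - (size X - i.+1)).

Section Part.
Variable X : seq nat.
Hypothesis uX : uniq X.

Lemma nth_sort_geq i :
  i.+1 < size X -> nth 0 (sort geq X) i.+1 < nth 0 (sort geq X) i.
Proof.
move=> ltiX.
have : sorted gtn (sort geq X).
  rewrite gtn_sorted_uniq_geq sort_uniq uX; apply: sort_sorted => x y /=; exact: leq_total.
by move/(sortedP 0); apply; rewrite size_sort.
Qed.

(** The entry at [i] has [size X - i.+1] distinct smaller entries after it. This makes the truncated
    subtraction in [part] exact. *)
Lemma nth_sort_ge i : i < size X -> size X - i.+1 <= nth 0 (sort geq X) i.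
Proof.
move=> ltiX; move e: (size X - i.+1) => k.
elim: k i ltiX e => // k IH i ltiX e.
have lt' : i.+1 < size X by lia.
have := nth_sort_geq lt'; have := IH _ lt'; lia.
Qed.

Lemma part_le i : i.+1 < size X ->
  nth 0 (sort geq X) i.+1 - (size X - i.+2) <= nth 0 (sort geq X) i - (size X - i.+1).
Proof. by move=> lt; have := nth_sort_geq lt; lia. Qed.

Lemma part_partition : is_partition (part X).
Proof. exact: (mkpartP part_le). Qed.

Lemma size_part : size (part X) <= size X.
Proof. exact: size_mkpart. Qed.

Lemma beta_part : beta (size X) (part X) =i X.
Proof.
suff -> : beta (size X) (part X) = sort geq X by move=> x; rewrite mem_sort.
apply: (@eq_from_nth _ 0); first by rewrite size_beta size_sort.
move=> i; rewrite size_beta => lti; rewrite nth_mkseq //.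
rewrite (nth_mkpart part_le) lti; have := nth_sort_ge lti; lia.
Qed.

Lemma part_unique la n : n = size X ->
  is_partition la -> size la <= n -> beta n la =i X -> part X = la.
Proof.
move=> -> pla sla e; apply: (@beta_inj (size X)) => //.
- exact: part_partition.
- exact: size_part.
- by move=> x; rewrite beta_part e.
Qed.

End Part.

(** * Hooks as bead-gap pairs; cores as flush bead sets *)

Definition flush t (X : seq nat) := forall x, x + t \in X -> x \in X.

(* The numbers [n + j - conjpart la j] are exactly the positions without bead,
   and the hook length of [(i, j)] is the distance from bead [i] to gap [j]. *)
Lemma gap_notin n la j : is_partition la -> size la <= n ->
  n + j - conjpart la j \notin beta n la.
Proof.
move=> pla sla; apply/negP => /mem_beta[i ltin].
have := count_size (fun x => j < x) la; rewrite -/(conjpart la j).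
have := ltn_conjpart i j pla.
have [ltij|leji] := ltnP j (nth 0 la i); lia.
Qed.

Lemma gap_surj n la x : is_partition la -> size la <= n ->
  x \notin beta n la -> exists j, x = n + j - conjpart la j.
Proof.
move=> pla sla xN.
(* The least such row [c] counts the beads above [x]; then [n - c] beads lie below [x], so
   [x - (n - c)] gaps do, which gives the column. *)
pose P i := (n <= i) || (nth 0 la i + (n - i.+1) < x).
have exP : exists i, P i by exists n; rewrite /P leqnn.
case: (ex_minnP exP) => c Pc cmin.
have lecn : c <= n by apply: cmin; rewrite /P leqnn.
have lec i : i < c -> x < nth 0 la i + (n - i.+1).
  move=> ltic; rewrite ltn_neqAle; apply/andP; split.
    by apply: contra xN => /eqP ->; apply/mem_beta; exists i => //; lia.
  by rewrite leqNgt; apply/negP => h; have := cmin i; rewrite /P h orbT; lia.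
have nlac : n = c -> nth 0 la c = 0 by move=> <-; rewrite nth_default.
exists (x - (n - c)); suff -> : conjpart la (x - (n - c)) = c.
  by move: Pc; rewrite /P; lia.
have hc := ltn_conjpart c (x - (n - c)) pla.
have hc' := ltn_conjpart c.-1 (x - (n - c)) pla.
have := lec c.-1; move: Pc; rewrite /P; case: (posnP c) => [c0|cgt0]; last first.
  by rewrite prednK //; lia.
by move: nlac; subst c; lia.
Qed.

(** A hook of length [t] is a bead with a gap [t] places below it. *)
Lemma core_flushP t la n : 0 < t -> is_partition la -> size la <= n ->
  is_core t la <-> flush t (beta n la).
Proof.
move=> t0 pla sla; split=> [[_ hk] x xt|fl].
- apply/negPn/negP => /(gap_surj pla sla)[j ej].
  case/mem_beta: xt => i ltin ei.
  have := count_size (fun x => j < x) la; rewrite -/(conjpart la j) => cs.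
  have cij := ltn_conjpart i j pla.
  have [ltj|] := ltnP j (nth 0 la i); last by lia.
  by apply: (hk i j) => //; rewrite /hook; lia.
- split=> // i j; rewrite /cell /= => ltj; rewrite /hook => e.
  have := gap_notin j pla sla; apply/negP/negPn; apply: fl.
  apply/mem_beta.
  have := count_size (fun x => j < x) la; rewrite -/(conjpart la j) => cs.
  have cij := ltn_conjpart i j pla.
  by exists i; lia.
Qed.


(** * Removing a rim hook moves one bead *)

(** Entry [p] leaves, the entries after it up to [q] move one place forward, and a new entry fills
    place [q]; all other terms cancel. Taking [F] to be the identity later gives sizes, and an
    indicator gives bead counts. *)
Lemma bead_shift_sum (F b b' : nat -> nat) n p q : p <= q < n ->
  (forall i, i < p -> b' i = b i) ->
  (forall i, p <= i < q -> b' i = b i.+1) ->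
  (forall i, q < i -> b' i = b i) ->
  \sum_(0 <= i < n) F (b i) + F (b' q) = \sum_(0 <= i < n) F (b' i) + F (b p).
Proof.
move=> /andP[lepq ltqn] h1 h2 h3.
rewrite !(@big_cat_nat _ _ _ p 0 n) //=; try lia.
rewrite !(@big_cat_nat _ _ _ q.+1 p n) //=; try lia.
rewrite big_nat_recl // [\sum_(p <= i < q.+1) F (b' i)]big_nat_recr //=.
have -> : \sum_(0 <= i < p) F (b' i) = \sum_(0 <= i < p) F (b i).
  by apply: eq_big_nat => i /andP[_ /h1 ->].
have -> : \sum_(p <= i < q) F (b' i) = \sum_(p <= i < q) F (b i.+1).
  by apply: eq_big_nat => i /h2 ->.
have -> : \sum_(q.+1 <= i < n) F (b' i) = \sum_(q.+1 <= i < n) F (b i).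
  by apply: eq_big_nat => i /andP[/h3 ->].
lia.
Qed.

Lemma sumn_nth s n : size s <= n -> sumn s = \sum_(0 <= i < n) nth 0 s i.
Proof.
move=> sn; rewrite sumnE (big_nth 0) [RHS](@big_cat_nat _ _ _ (size s)) //=.
rewrite [X in _ = _ + X]big_nat_cond [X in _ = _ + X]big1 ?addn0 // => i.
by rewrite andbT => /andP[h _]; rewrite nth_default.
Qed.

Lemma count_beta (a : pred nat) n la :
  count a (beta n la) = \sum_(0 <= i < n) a (nth 0 la i + (n - i.+1)).
Proof.
rewrite -sum1_count /beta /mkseq big_map big_mkcond /= /index_iota subn0.
by apply: eq_bigr => i _; case: (a _).
Qed.

(* [mu] arises from [la] by removing a rim hook meeting exactly the rows [p..q]:
   in terms of beads, [mu_i] takes the place of [la_(i+1)] for [p <= i < q]. *)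
Definition strip la mu p q :=
  [/\ forall i, i < p -> nth 0 mu i = nth 0 la i,
      forall i, p <= i < q -> nth 0 la i.+1 = (nth 0 mu i).+1 &
      forall i, q < i -> nth 0 mu i = nth 0 la i].

Lemma strip_sum F la mu p q n : p <= q < n -> strip la mu p q ->
  \sum_(0 <= i < n) F (nth 0 la i + (n - i.+1)) + F (nth 0 mu q + (n - q.+1)) =
  \sum_(0 <= i < n) F (nth 0 mu i + (n - i.+1)) + F (nth 0 la p + (n - p.+1)).
Proof.
move=> pqn [h1 h2 h3].
apply: (@bead_shift_sum F (fun i => nth 0 la i + (n - i.+1))
                          (fun i => nth 0 mu i + (n - i.+1))) => // i hi /=.
- by rewrite h1.
- by rewrite h2 //; lia.
- by rewrite h3.
Qed.

Lemma strip_sumn la mu p q n : size la <= n -> size mu <= n -> p <= q < n ->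
  strip la mu p q ->
  sumn la + (nth 0 mu q + (n - q.+1)) = sumn mu + (nth 0 la p + (n - p.+1)).
Proof.
move=> sla smu pqn st; have := strip_sum id pqn st; rewrite /= !big_split /=.
rewrite -!sumn_nth //; lia.
Qed.

Lemma nth_containment la mu : (forall c, cell mu c -> cell la c) ->
  forall i, nth 0 mu i <= nth 0 la i.
Proof.
move=> sub i; rewrite leqNgt; apply/negP => h.
by have := sub (i, nth 0 la i); rewrite /cell /= ltnn h => /(_ isT).
Qed.

Lemma size_containment la mu : is_partition la -> is_partition mu ->
  (forall c, cell mu c -> cell la c) -> size mu <= size la.
Proof.
move=> pla pmu /nth_containment h; rewrite leqNgt; apply/negP.
rewrite -(part_nth_gt0 _ pmu) => h'.
have := part_nth_gt0 (size la) pla; rewrite ltnn.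
by rewrite (leq_trans h' (h _)).
Qed.

(** Take [p] and [q] to be the first and last rows that change. Connectedness makes consecutive rows
    of the skew shape share a column, and the absence of a 2 by 2 square makes them share at most
    one. *)
Lemma removal_strip t la mu n : 0 < t -> is_partition la -> size la <= n ->
  rim_hook_removal t la mu -> exists p q, p <= q < n /\ strip la mu p q.
Proof.
move=> t0 pla sla [pmu sub sm conn no22].
have le := nth_containment sub; have smu := size_containment pla pmu sub.
pose D i := nth 0 mu i < nth 0 la i.
have Dbound i : D i -> i <= n.
  rewrite /D => h; apply: leq_trans sla; apply: ltnW.
  by rewrite -part_nth_gt0 //; lia.
have exD : exists i, D i.
  have [/hasP[i _ Di]|/hasPn nD] := boolP (has D (iota 0 n.+1)); first by exists i.
  exfalso; suff e : la = mu by move: sm; rewrite e; lia.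
  apply: part_ext => // i; apply/eqP; rewrite eqn_leq le andbT leqNgt.
  apply/negP => h; have : i \in iota 0 n.+1 by rewrite mem_iota /= ltnS; exact: Dbound.
  by move/nD/negP; apply.
case: (ex_minnP exD) => p Dp minp; case: (ex_maxnP exD Dbound) => q Dq maxq.
have lepq : p <= q by apply: minp.
have skD i : D i -> skew la mu (i, nth 0 mu i).
  by move=> Di; rewrite /skew /cell /= -leqNgt leqnn andbT.
have ltqn : q < n.
  by apply: leq_trans sla; rewrite -part_nth_gt0 //; move: Dq; rewrite /D; lia.
exists p, q; split; first by rewrite lepq.
split=> i hi.
- by apply/eqP; rewrite eqn_leq le leqNgt; apply/negP => /minp; lia.
(* Otherwise rows [i] and [i.+1] of the skew shape share no column, and a path from row [p] can
   never get below row [i], hence never to row [q]. *)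
- have step : nth 0 mu i < nth 0 la i.+1.
    rewrite ltnNge; apply/negP => bar.
    have stay : forall s c, path adjacent c s -> skew la mu c ->
        all (skew la mu) s -> c.1 <= i -> (last c s).1 <= i.
      elim=> [|d s IH] c //= /andP[adj pth] sc /andP[sd sall] lec.
      apply: IH => //; move: adj sc sd; rewrite /adjacent /skew /cell.
      case: c lec => a b; case: d {pth} => a' b' /= lea adj sc sd.
      rewrite leqNgt; apply/negP => ltia'.
      have [ea ea'] : a = i /\ a' = i.+1 by lia.
      by move: adj sc sd; rewrite ea ea'; lia.
    have [s /and3P[pth /eqP ls als]] := conn _ _ (skD _ Dp) (skD _ Dq).
    by have := stay _ _ pth (skD _ Dp) als; rewrite ls /=; lia.
  (* Two shared columns would put a 2 by 2 square at [(i, nth 0 mu i)]. *)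
  apply/eqP; rewrite eqn_leq step andbT leqNgt; apply/negP => h.
  apply: no22; exists i, (nth 0 mu i); rewrite /skew /cell /= .
  have := part_nth_le pla (leqnSn i); have := part_nth_le pmu (leqnSn i); lia.
- by apply/eqP; rewrite eqn_leq le leqNgt; apply/negP => /maxq; lia.
Qed.

(** The size drops by [t], so the bead that leaves stands exactly [t] above the one that appears,
    and a [t]-periodic predicate does not tell them apart. *)
Lemma removal_count t la mu n (a : pred nat) : 0 < t ->
  (forall x, a (x + t) = a x) ->
  is_partition la -> size la <= n -> rim_hook_removal t la mu ->
  count a (beta n la) = count a (beta n mu).
Proof.
move=> t0 at_a pla sla rem; have [p [q [pqn st]]] := removal_strip t0 pla sla rem.
case: rem => pmu sub sm _ _.
have smu := leq_trans (size_containment pla pmu sub) sla.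
have e := strip_sumn sla smu pqn st.
have := strip_sum a pqn st; rewrite -!count_beta.
have -> : nth 0 la p + (n - p.+1) = nth 0 mu q + (n - q.+1) + t by lia.
rewrite at_a; lia.
Qed.

(** * Conversely, moving a bead down removes a rim hook *)

Section RimHook.
Variables (la mu : seq nat) (p q : nat).
Hypotheses (pla : is_partition la) (pmu : is_partition mu).
Hypotheses (lepq : p <= q) (st : strip la mu p q) (ltq : nth 0 mu q < nth 0 la q).

Lemma strip_sub c : cell mu c -> cell la c.
Proof.
case: st => h1 h2 h3; case: c => i j; rewrite /cell /=.
have [ltip|] := ltnP i p; first by rewrite h1.
have [ltqi|leiq] := ltnP q i; first by rewrite h3.
have [->|neq] := eqVneq i q; first by lia.
have := h2 i; have := part_nth_le pla (leqnSn i); lia.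
Qed.

Lemma strip_rows i j : skew la mu (i, j) -> p <= i <= q.
Proof.
case: st => h1 _ h3; rewrite /skew /cell /=.
have [ltip|] := ltnP i p; first by rewrite h1 //; lia.
by have [ltqi|leiq] := ltnP q i; first by rewrite h3 //; lia.
Qed.

(** Row [i.+1] of [la] ends just one cell beyond row [i] of [mu], which leaves no room for a
    diagonal step. *)
Lemma strip_no_square i j : skew la mu (i, j) -> skew la mu (i.+1, j.+1) -> False.
Proof.
move=> s1 s2; have r1 := strip_rows s1; have r2 := strip_rows s2.
by case: st => _ h2 _; move: s1 s2; rewrite /skew /cell /=; have := h2 i; lia.
Qed.

Definition linked c d :=
  exists s : seq (nat * nat), [&& path adjacent c s, last c s == d & all (skew la mu) s].

Lemma linked_refl c : linked c c.
Proof. by exists [::]; rewrite /= eqxx. Qed.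

Lemma linked_step c d e : adjacent c d -> skew la mu d -> linked d e -> linked c e.
Proof.
by move=> ad sd [s /and3P[h1 h2 h3]]; exists (d :: s); rewrite /= ad h1 sd h2.
Qed.

Lemma linked_rstep c d e : linked c d -> adjacent d e -> skew la mu e -> linked c e.
Proof.
move=> [s /and3P[h1 /eqP h2 h3]] ad se; exists (rcons s e).
by rewrite rcons_path h1 h2 ad last_rcons eqxx all_rcons se h3.
Qed.

Lemma adjacentC : symmetric adjacent.
Proof. by move=> c d; rewrite /adjacent; lia. Qed.

(* Walking left along a row and then down, the content drops by one at each
   step, so every cell reaches the last cell of the strip. *)
Lemma strip_linked c : skew la mu c ->
  linked c (q, nth 0 mu q) /\ linked (q, nth 0 mu q) c.
Proof.
case: c => i j; move e: (j + (q - i)) => k.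
elim: k i j e => [|k IH] i j e sc; have /andP[lepi leiq] := strip_rows sc.
all: have hq : i = q -> j = nth 0 mu q ->
       linked (i, j) (q, nth 0 mu q) /\ linked (q, nth 0 mu q) (i, j)
  by move=> -> ->; split; exact: linked_refl.
all: have sc' : nth 0 mu i <= j < nth 0 la i by move: sc; rewrite /skew /cell /=; lia.
  have ei : i = q by lia.
  by apply: hq; rewrite -?ei; lia.
suff next c : skew la mu c -> adjacent (i, j) c -> c.2 + (q - c.1) = k ->
    linked (i, j) (q, nth 0 mu q) /\ linked (q, nth 0 mu q) (i, j).
  have [ltj|lej] := ltnP (nth 0 mu i) j.
    by apply: (next (i, j.-1)); rewrite /skew /cell /adjacent /=; lia.
  have [ei|neiq] := eqVneq i q; first by apply: hq; rewrite -?ei; lia.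
  case: st => _ h2 _; have := h2 i => h2i.
  have := part_nth_le pmu (leqnSn i) => lei.
  by apply: (next (i.+1, j)); rewrite /skew /cell /adjacent /=; lia.
case: c => i' j' sc2 ad /= e2; have [l1 l2] := IH _ _ e2 sc2; split.
  exact: linked_step ad sc2 l1.
by apply: linked_rstep l2 _ sc; rewrite adjacentC.
Qed.

Lemma linked_trans c d e : linked c d -> linked d e -> linked c e.
Proof.
move=> [s /and3P[h1 /eqP h2 h3]] [r /and3P[k1 k2 k3]]; exists (s ++ r).
by rewrite cat_path h1 h2 k1 last_cat h2 k2 all_cat h3.
Qed.

Lemma strip_removal t : sumn la = sumn mu + t -> rim_hook_removal t la mu.
Proof.
move=> e; split=> //; first exact: strip_sub.
  move=> c d sc sd.
  exact: linked_trans (strip_linked sc).1 (strip_linked sd).2.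
by case=> i [j /and4P[s1 _ _ s2]]; exact: strip_no_square s1 s2.
Qed.

End RimHook.

Lemma movable_removal t la n x : 0 < t -> is_partition la -> size la <= n ->
  x + t \in beta n la -> x \notin beta n la -> exists mu, rim_hook_removal t la mu.
Proof.
move=> t0 pla sla /mem_beta[p ltpn ep] xN.
pose D i := (i < n) && (x < nth 0 la i + (n - i.+1)).
have Dp : D p by rewrite /D ltpn /=; lia.
have exD : exists i, D i by exists p.
have Dbound i : D i -> i <= n by case/andP=> /ltnW.
(* [q] is the last row with its bead above [x], hence the row that the moved bead will occupy. *)
case: (ex_maxnP exD Dbound) => q /andP[ltqn ltxq] maxq.
have lepq : p <= q by apply: maxq.
have after i : q < i < n -> nth 0 la i + (n - i.+1) < x.
  move=> /andP[ltqi ltin]; rewrite ltn_neqAle; apply/andP; split.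
    by apply: contra xN => /eqP <-; apply/mem_beta; exists i.
  by rewrite leqNgt; apply/negP => h; have := maxq i; rewrite /D ltin h; lia.
(* The rows after the move: beads [p.+1] to [q] keep their positions but gain one place in the
   order, so their rows shrink by one; row [q] is read off from the position [x]. *)
pose f i := if i < p then nth 0 la i else if i < q then (nth 0 la i.+1).-1
            else if i == q then x - (n - q.+1) else nth 0 la i.
have mono := part_nth_le pla.
have xq : n - q.+1 <= x by have := after q.+1; lia.
have fle i : i.+1 < n -> f i.+1 <= f i.
  move=> lti; have m0 := mono _ _ (leqnSn i); have m1 := mono _ _ (leqnSn i.+1).
  have ai := after i.+1.
  by rewrite /f; case: (ltngtP i p); case: (ltngtP i q); case: (ltngtP i.+1 p); case: (ltngtP i.+1 q); intros; subst; lia.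
have fn i : nth 0 (mkpart n f) i = f i.
  rewrite nth_mkpart //; case: ltnP => // lein; rewrite /f.
  by rewrite !ifN ?nth_default //; try lia; rewrite (leq_trans sla).
have fq : f q = x - (n - q.+1) by rewrite /f eqxx ltnn ifN //; lia.
have st : strip la (mkpart n f) p q.
  split=> i hi; rewrite fn /f.
  - by rewrite hi.
  - by have := mono i.+1 q; rewrite ifN ?ifT; lia.
  - by rewrite !ifN //; lia.
exists (mkpart n f); apply: (strip_removal pla (mkpartP fle) lepq st).
  by rewrite fn fq; lia.
have pqn : p <= q < n by rewrite lepq.
have := strip_sumn sla (size_mkpart n f) pqn st; rewrite fn fq; lia.
Qed.

(** * Residue counts determine the core *)

Definition resc (t a : nat) (X : seq nat) := count (fun x => x %% t == a) X.

Lemma flush_sub t X x k : flush t X -> x \in X -> k * t <= x -> x - k * t \in X.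
Proof.
move=> fl xX; elim: k => [|k IH]; first by rewrite mul0n subn0.
rewrite mulSn => le; apply: fl; have -> : x - (t + k * t) + t = x - k * t by lia.
by apply: IH; lia.
Qed.

Lemma flush_below t X x y : flush t X -> y \in X -> x <= y ->
  x = y %[mod t] -> x \in X.
Proof.
move=> fl yX lexy; move/eqP; rewrite eq_sym eqn_mod_dvd // => /dvdnP[k e].
have -> : x = y - k * t by lia.
by apply: flush_sub => //; lia.
Qed.

(** If [x] is in [X] but not in [Y], flushness of [Y] keeps its beads in the class of [x] below [x],
    and flushness of [X] puts them all in [X]. With [x] itself, [X] then has more beads in that
    class than [Y]. *)
Lemma flush_sub_resc t X Y : uniq X -> uniq Y -> flush t X -> flush t Y ->
  (forall a, resc t a X = resc t a Y) -> {subset X <= Y}.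
Proof.
move=> uX uY fX fY e x xX; apply/negPn/negP => xNY.
have := e (x %% t); rewrite /resc -!size_filter => ee.
have lt y : y \in Y -> y = x %[mod t] -> y < x.
  move=> yY emod; rewrite ltnNge; apply/negP => lexy.
  by move: xNY; rewrite (flush_below fY yY lexy).
have : {subset x :: [seq y <- Y | y %% t == x %% t] <= [seq y <- X | y %% t == x %% t]}.
  move=> y; rewrite inE => /predU1P[->|]; first by rewrite mem_filter eqxx.
  rewrite !mem_filter => /andP[/eqP emod yY]; rewrite emod eqxx /=.
  by apply: (flush_below fX xX) => //; apply/ltnW/lt.
move/uniq_leq_size; rewrite /= ee ltnn filter_uniq // andbT mem_filter negb_and xNY orbT.
by move/(_ isT).
Qed.

Lemma removal_chain t la al n : 0 < t ->
  clos_refl_trans (seq nat) (rim_hook_removal t) la al ->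
  is_partition la -> size la <= n ->
  [/\ is_partition al, size al <= n &
      forall a, resc t a (beta n la) = resc t a (beta n al)].
Proof.
move=> t0; elim=> {la al} [la mu rem|la|la mu al _ IH1 _ IH2] pla sla //.
  have [pmu sub _ _ _] := rem; split=> //.
    exact: leq_trans (size_containment pla pmu sub) sla.
  move=> a; apply: (removal_count t0 _ pla sla rem) => x.
  by rewrite modnDr.
have [pmu smu e1] := IH1 pla sla; have [pal sal e2] := IH2 pmu smu.
by split=> // a; rewrite e1.
Qed.

(** Each removal lowers [sumn] by [t], so removals terminate; this supplies the witness for the
    [epsilon] in [core]. *)
Lemma core_of_exists t la : 0 < t -> exists al, is_core_of t la al.
Proof.
move=> t0; have [k] := ubnP (sumn la); elim: k la => // k IH la le.
have [[mu rem]|no] := classic (exists mu, rim_hook_removal t la mu).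
  have [|al [chain stop]] := IH mu; first by case: rem; lia.
  by exists al; split=> //; apply: rt_trans chain; apply: rt_step.
by exists la; split=> //; apply: rt_refl.
Qed.

Lemma core_spec t la : 0 < t -> is_core_of t la (core t la).
Proof. by move=> /(core_of_exists la); exact: epsilon_spec. Qed.

(** Removals preserve residue counts and stop only at a flush bead set, and a flush set is
    determined by its residue counts. *)
Lemma coreP t n la al : 0 < t -> is_partition la -> size la <= n ->
  is_core t al -> size al <= n ->
  core t la = al <-> forall a, resc t a (beta n la) = resc t a (beta n al).
Proof.
move=> t0 pla sla cal sal; have [chain stop] := core_spec la t0.
have [pc sc e] := removal_chain t0 chain pla sla; split=> [<- //|e'].
have pal : is_partition al by case: cal.
have fl : flush t (beta n (core t la)).
  move=> x xt; apply/negPn/negP => xN; apply: stop.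
  exact: movable_removal xt xN.
have /(core_flushP t0 pal sal) fa := cal.
apply: (beta_inj pc pal sc sal) => x; apply/idP/idP.
  by apply: (@flush_sub_resc t) => //; rewrite ?beta_uniq // => a; rewrite -e e'.
by apply: (@flush_sub_resc t) => //; rewrite ?beta_uniq // => a; rewrite -e e'.
Qed.

(** * Counting predicates, and finiteness of the sets of cores *)

(* [fcard] alone would denote the notation of fingraph. *)
Lemma fcardE (P : seq nat -> Prop) s :
  uniq s -> (forall x, x \in s <-> P x) -> Defs.fcard P = size s.
Proof.
move=> us sP; have ex : exists n, exists s', [/\ uniq s', size s' = n & forall x, x \in s' <-> P x].
  by exists (size s), s.
have [s' [us' e' s'P]] := epsilon_spec (inhabits 0) _ ex; rewrite /Defs.fcard -{}e'.
have e : s =i s' by move=> x; apply/idP/idP; rewrite ?(sP, s'P) // => h; apply/s'P/sP.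
by symmetry; apply: perm_size; rewrite uniq_perm.
Qed.

Lemma enumerable (P : seq nat -> Prop) (L : seq (seq nat)) : (forall x, P x -> x \in L) ->
  exists s : seq (seq nat), uniq s /\ forall x, x \in s <-> P x.
Proof.
move=> PL; pose b x : bool := excluded_middle_informative (P x).
exists (undup [seq x <- L | b x]); split; first exact: undup_uniq.
move=> x; rewrite mem_undup mem_filter /b.
by case: excluded_middle_informative => h /=; split=> //; move/PL.
Qed.

(** The hypotheses make [phi] a bijection onto the families of solutions of the [Q j]. Numbering
    each [Q j] by a list turns these families into index vectors, counted by [card_family]. *)
Lemma fcard_prod d (P : seq nat -> Prop) (Q : 'I_d -> seq nat -> Prop)
    (phi : 'I_d -> seq nat -> seq nat) :
  (forall j, exists L : seq (seq nat), forall x, Q j x -> x \in L) ->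
  (forall x j, P x -> Q j (phi j x)) ->
  (forall x y, P x -> P y -> phi^~ x =1 phi^~ y -> x = y) ->
  (forall q, (forall j, Q j (q j)) -> exists x, P x /\ phi^~ x =1 q) ->
  Defs.fcard P = \prod_(j < d) Defs.fcard (Q j).
Proof.
move=> finQ PQ inj surj.
have /fin_all_exists[L LP] : forall j, exists s : seq (seq nat), uniq s /\ forall x, x \in s <-> Q j x.
  by move=> j; have [L] := finQ j; exact: enumerable.
(* A common bound on all list indices, so that index vectors share one codomain. *)
pose M := (\max_j size (L j)).+1.
have ltM j i : i < size (L j) -> i < M.
  by move=> h; rewrite ltnS (leq_trans (ltnW h)) // leq_bigmax.
pose F j := [pred i : 'I_M | i < size (L j)].
have cardF j : #|F j| = size (L j).
  rewrite -[RHS]card_ord; pose h (i : 'I_(size (L j))) : 'I_M := Ordinal (ltM j i (ltn_ord i)).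
  have hinj : injective h by move=> a b /(congr1 val) /= /val_inj.
  rewrite -(card_imset _ hinj); apply: eq_card => i; rewrite !inE; apply/idP/imsetP.
    by move=> hi; exists (Ordinal hi) => //; apply: val_inj.
  by case=> k _ ->; exact: (ltn_ord k).
pose q (f : {ffun 'I_d -> 'I_M}) j := nth [::] (L j) (f j).
pose G f := epsilon (inhabits [::]) (fun x => P x /\ phi^~ x =1 q f).
have GP f : f \in family F -> P (G f) /\ phi^~ (G f) =1 q f.
  move=> /familyP fF.
  apply: (epsilon_spec (inhabits [::]) (fun x => P x /\ phi^~ x =1 q f)).
  apply: surj => j.
  by apply/(LP j).2/mem_nth; exact: fF.
have Ginj : {in family F &, injective G}.
  move=> f g fF gF e; apply/ffunP => j; apply: val_inj.
  have := (GP _ fF).2 j; rewrite /= e (GP _ gF).2 /q => /eqP.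
  move/familyP/(_ j): fF => fF; move/familyP/(_ j): gF => gF.
  by rewrite nth_uniq ?(LP j).1 // => /eqP.
rewrite (@fcardE P [seq G f | f in family F]).
- rewrite size_map -cardE card_family foldrE big_map big_enum /=.
  by apply: eq_bigr => j _; rewrite cardF (fcardE (LP j).1 (LP j).2).
- by rewrite map_inj_in_uniq ?enum_uniq // => f g; rewrite !mem_enum; exact: Ginj.
move=> x; split=> [/mapP[f]|Px]; first by rewrite mem_enum => /GP[? _] ->.
have idx j : index (phi j x) (L j) < size (L j) by rewrite index_mem; apply/(LP j).2/PQ.
pose f := [ffun j => Ordinal (ltM j _ (idx j))].
have fF : f \in family F by apply/familyP => j; rewrite ffunE; exact: idx.
apply/mapP; exists f; rewrite ?mem_enum //; have [PG e] := GP _ fF.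
apply: inj => // j; rewrite e /q ffunE /= nth_index //; apply/(LP j).2/PQ => //.
Qed.

Fixpoint bounded_seqs n N : seq (seq nat) :=
  if n is n'.+1 then [::] :: [seq x :: s | x <- iota 0 N, s <- bounded_seqs n' N]
  else [:: [::]].

Lemma mem_bounded_seqs n N s : size s <= n -> all (gtn N) s -> s \in bounded_seqs n N.
Proof.
elim: n s => [|n IH] [|x s] //= sn /andP[ltx als].
by rewrite inE /=; apply: allpairs_f; rewrite ?mem_iota //; apply: IH.
Qed.

(** A larger [x] could be lowered by [t] as often as [size X] times inside [X], giving [size X + 1]
    distinct elements. *)
Lemma flush_bound t X x : 0 < t -> flush t X -> x \in X -> x < size X * t.
Proof.
move=> t0 fl xX; rewrite ltnNge; apply/negP => le.
have : {subset [seq x - k * t | k <- iota 0 (size X).+1] <= X}.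
  move=> y /mapP[k]; rewrite mem_iota => /= lek ->; apply: flush_sub => //.
  by apply: leq_trans le; rewrite leq_mul2r; lia.
move/uniq_leq_size; rewrite size_map size_iota ltnn map_inj_in_uniq ?iota_uniq; first by move/(_ isT).
move=> k l; rewrite !mem_iota => hk hl e.
have hkX : k * t <= size X * t by rewrite leq_mul2r; lia.
have hlX : l * t <= size X * t by rewrite leq_mul2r; lia.
have /eqP : k * t = l * t by lia.
by rewrite eqn_mul2r; lia.
Qed.

Lemma cores_enumerable t n : 0 < t ->
  exists L : seq (seq nat), forall la, is_core t la -> size la <= n -> la \in L.
Proof.
move=> t0; exists (bounded_seqs n (n * t)) => la cla sla.
have pla : is_partition la by case: cla.
have /(core_flushP t0 pla sla) fl := cla.
apply: mem_bounded_seqs => //; apply/(all_nthP 0) => i lti /=.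
have : nth 0 la i + (n - i.+1) \in beta n la by apply/mem_beta; exists i => //; lia.
by move/(flush_bound t0 fl); rewrite size_beta; lia.
Qed.

(** * Splitting a bead set into its runners modulo [d] *)

(** Runner [j] of the [d]-abacus; through [part] it yields a component of the [d]-quotient. *)
Definition quot d j (X : seq nat) := [seq x %/ d | x <- X & x %% d == j].

Lemma mem_quot d j X y : j < d -> (y \in quot d j X) = (y * d + j \in X).
Proof.
move=> ltjd; apply/mapP/idP => [[x]|h].
  by rewrite mem_filter => /andP[/eqP <- xX] ->; rewrite -divn_eq.
exists (y * d + j); last by rewrite divnMDl ?divn_small ?addn0 //; lia.
by rewrite mem_filter modnMDl modn_small // eqxx.
Qed.

Lemma quot_uniq d j X : uniq X -> uniq (quot d j X).
Proof.
move=> uX; rewrite map_inj_in_uniq ?filter_uniq // => x y.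
rewrite !mem_filter => /andP[/eqP ex _] /andP[/eqP ey _] e.
by rewrite (divn_eq x d) (divn_eq y d) ex ey e.
Qed.

Lemma size_quot d j X : size (quot d j X) = resc d j X.
Proof. by rewrite size_map size_filter. Qed.

Lemma modn_mulr x s d : 0 < s -> 0 < d -> x %% (s * d) = (x %/ d) %% s * d + x %% d.
Proof.
move=> s0 d0; have h : (x %/ d) %% s * d + x %% d < s * d.
  have := ltn_pmod (x %/ d) s0; have := ltn_pmod x d0; nia.
by rewrite [in LHS](divn_eq x d) [in LHS](divn_eq (x %/ d) s) mulnDl -mulnA -addnA modnMDl modn_small.
Qed.

Lemma resc_quot s d a j X : 0 < s -> j < d ->
  resc s a (quot d j X) = resc (s * d) (a * d + j) X.
Proof.
move=> s0 ltjd; rewrite /resc count_map count_filter; apply: eq_count => x /=.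
have d0 : 0 < d by lia.
rewrite modn_mulr //; apply/andP/eqP => [[/eqP -> /eqP ->] //|e].
have e1 : x %% d = j by have := congr1 (modn^~ d) e; rewrite /= !modnMDl modn_mod (modn_small ltjd).
by move: e; rewrite e1 => /addIn/eqP; rewrite eqn_mul2r eqn0Ngt d0 => /eqP ->.
Qed.

Lemma size_resc t X : 0 < t -> size X = \sum_(a < t) resc t a X.
Proof.
move=> t0; elim: X => [|x X IH] /=; first by rewrite big1.
rewrite big_split /= -IH (bigD1 (Ordinal (ltn_pmod x t0))) //= eqxx big1 ?addn0 //.
by move=> a; rewrite -val_eqE /= eq_sym => /negPf ->.
Qed.

(** A move by [m * d] stays on its runner and is a move by [m] there. *)
Lemma flush_quot m d X : 0 < d -> flush (m * d) X <-> forall j, j < d -> flush m (quot d j X).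
Proof.
move=> d0; split=> [fl j ltj x|fl x].
  by rewrite !mem_quot // => h; apply: fl; move: h; rewrite mulnDl addnAC.
rewrite [x in x + _](divn_eq x d) addnAC -mulnDl -mem_quot ?ltn_pmod //.
by move/(fl _ (ltn_pmod x d0)); rewrite mem_quot ?ltn_pmod // -divn_eq.
Qed.

Lemma flush_eq_mem t X Y : X =i Y -> flush t X -> flush t Y.
Proof. by move=> e fl x; rewrite -!e; exact: fl. Qed.

Lemma resc_eq_mem t a X Y : uniq X -> uniq Y -> X =i Y -> resc t a X = resc t a Y.
Proof. by move=> uX uY e; apply/permP/uniq_perm. Qed.

Lemma part_core t X : 0 < t -> uniq X -> flush t X -> is_core t (part X).
Proof.
move=> t0 uX fl; apply/(core_flushP t0 (part_partition uX) (size_part X)).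
by apply: flush_eq_mem fl => x; rewrite beta_part.
Qed.

(** This is [coreP] read on bead sets; equal sizes let both partitions be encoded with the same
    number of beads. *)
Lemma core_part t X Y : 0 < t -> uniq X -> uniq Y -> size X = size Y -> flush t Y ->
  core t (part X) = part Y <-> forall a, resc t a X = resc t a Y.
Proof.
move=> t0 uX uY e fl.
have [pX pY] := (part_partition uX, part_partition uY).
have sY : size (part Y) <= size X by rewrite e size_part.
rewrite (coreP t0 pX (size_part X) (part_core t0 uY fl) sY).
have eX a : resc t a (beta (size X) (part X)) = resc t a X.
  by apply: resc_eq_mem; rewrite ?beta_uniq // => x; rewrite beta_part.
have eY a : resc t a (beta (size X) (part Y)) = resc t a Y.
  by rewrite e; apply: resc_eq_mem; rewrite ?beta_uniq // => x; rewrite beta_part.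
by split=> h a; have := h a; rewrite eX eY.
Qed.

Lemma resc_sum s d j X : 0 < s -> j < d ->
  resc d j X = \sum_(a < s) resc (s * d) (a * d + j) X.
Proof.
move=> s0 ltjd; rewrite -size_quot (size_resc _ s0).
by apply: eq_bigr => a _; rewrite resc_quot.
Qed.

Lemma eq_mem_quot d X Y : 0 < d ->
  (forall j, j < d -> quot d j X =i quot d j Y) -> X =i Y.
Proof.
by move=> d0 e x; rewrite (divn_eq x d) -!mem_quot ?ltn_pmod // e ?ltn_pmod.
Qed.

(** * The product formula for a fixed number of beads *)

Lemma Ncount_quot n s t d sigma tau : 0 < s -> 0 < t -> 0 < d ->
  is_core (s * d) sigma -> is_core (t * d) tau ->
  size sigma <= n -> size tau <= n ->
  (forall j, j < d -> resc d j (beta n sigma) = resc d j (beta n tau)) ->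
  Ncount (s * d) (t * d) sigma tau n =
  \prod_(j < d) Ncount s t (part (quot d j (beta n sigma)))
                           (part (quot d j (beta n tau))) (resc d j (beta n sigma)).
Proof.
move=> s0 t0 d0 cs ct ssig stau lst.
have psig : is_partition sigma by case: cs.
have ptau : is_partition tau by case: ct.
have [sd0 td0] : 0 < s * d /\ 0 < t * d by rewrite !muln_gt0 s0 t0.
have m0 : 0 < lcmn s t by rewrite lcmn_gt0 s0.
have md0 : 0 < lcmn s t * d by rewrite muln_gt0 m0.
have [usig utau] := (beta_uniq n psig, beta_uniq n ptau).
have /(core_flushP sd0 psig ssig)/(flush_quot _ _ d0) fsig := cs.
have /(core_flushP td0 ptau stau)/(flush_quot _ _ d0) ftau := ct.
rewrite /Ncount -muln_lcml.
apply: (fcard_prod (phi := fun j la => part (quot d j (beta n la)))) => /=.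
- move=> j; have [L LP] := cores_enumerable (resc d j (beta n sigma)) m0.
  by exists L => la [cla _ _ sla]; exact: LP.
- move=> la j [cla csig ctau sla]; have ltj := ltn_ord j.
  have pla : is_partition la by case: cla.
  have ula := beta_uniq n pla; have uq := quot_uniq d j ula.
  have /(core_flushP md0 pla sla)/(flush_quot _ _ d0) fla := cla.
  move/(coreP sd0 pla sla cs ssig): csig => esig.
  move/(coreP td0 pla sla ct stau): ctau => etau.
  (* The runner sizes of [la] are sums of residue counts modulo [s * d], which its core [sigma]
     prescribes. *)
  have sz : size (quot d j (beta n la)) = resc d j (beta n sigma).
    rewrite size_quot !(resc_sum _ s0) //.
    by apply: eq_bigr => a _; rewrite esig.
  split.
  + exact: part_core (fla _ ltj).
  + apply/core_part; rewrite ?quot_uniq //; first by rewrite sz size_quot.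
      exact: fsig.
    by move=> a; rewrite !resc_quot // esig.
  + apply/core_part; rewrite ?quot_uniq //; first by rewrite sz size_quot lst.
      exact: ftau.
    by move=> a; rewrite !resc_quot // etau.
  + by rewrite /plen -sz size_part.
- move=> x y [cx csx _ sx] [cy csy _ sy] e.
  have px : is_partition x by case: cx.
  have py : is_partition y by case: cy.
  move/(coreP sd0 px sx cs ssig): csx => ex.
  move/(coreP sd0 py sy cs ssig): csy => ey.
  apply: (beta_inj px py sx sy); apply: (eq_mem_quot d0) => j ltj v.
  (* [part] forgets the number of beads, so a runner is recovered from its partition only once its
     size is known. *)
  have sz : size (quot d j (beta n x)) = size (quot d j (beta n y)).
    rewrite !size_quot !(resc_sum _ s0) //.
    by apply: eq_bigr => a _; rewrite ex ey.
  have /= ej := e (Ordinal ltj).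
  rewrite -(beta_part (quot_uniq d j (beta_uniq n px))) ej sz beta_part //.
  by rewrite quot_uniq ?beta_uniq.
- move=> q Qq; pose l j := resc d j (beta n sigma).
  have pq j : is_partition (q j) by case: (Qq j) => -[].
  have sq j : size (q j) <= l j by case: (Qq j).
  (* Surjectivity: encode each [q j] with [l j] beads and interleave the results as runners. *)
  pose X := undup (flatten [seq [seq y * d + j | y <- beta (l j) (q j)] | j : 'I_d]).
  have uX : uniq X by exact: undup_uniq.
  have memX (j : 'I_d) : quot d j X =i beta (l j) (q j).
    move=> y; rewrite mem_quot // mem_undup; apply/flatten_mapP/idP => [[i _]|yb].
      case/mapP=> z zb e.
      have eij : j = i.
        apply: val_inj; have := congr1 (modn^~ d) e.
        by rewrite /= !modnMDl !modn_small.
      move: e zb; rewrite eij => /addIn/eqP; rewrite eqn_mul2r eqn0Ngt d0 /=.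
      by move/eqP->.
    by exists j; [rewrite mem_enum | apply/mapP; exists y].
  (* The [l j] are the runner sizes of [beta n sigma], so they add up to [n]. *)
  have sX : size X = n.
    rewrite (size_resc _ d0) -[RHS](size_beta n sigma) (size_resc _ d0).
    apply: eq_bigr => j _; rewrite -[RHS]/(l j) -(size_beta (l j) (q j)) -size_quot.
    by apply/perm_size/uniq_perm; rewrite ?quot_uniq ?beta_uniq.
  have memla : beta n (part X) =i X by rewrite -sX; exact: beta_part.
  have pX := part_partition uX.
  have sla : size (part X) <= n by rewrite -sX size_part.
  have memq (j : 'I_d) : quot d j (beta n (part X)) =i beta (l j) (q j).
    by move=> y; rewrite -memX !mem_quot // memla.
  have uq (j : 'I_d) : uniq (quot d j (beta n (part X))).
    by rewrite quot_uniq ?beta_uniq.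
  have szq (j : 'I_d) : l j = size (quot d j (beta n (part X))).
    rewrite -[LHS](size_beta _ (q j)).
    by apply/perm_size/uniq_perm; rewrite ?beta_uniq // => y; rewrite memq.
  have qE (j : 'I_d) : part (quot d j (beta n (part X))) = q j.
    apply: (part_unique (uq j) (szq j)) => // y; by rewrite memq.
  exists (part X); split; last exact: qE.
  split.
  + apply/(core_flushP md0 pX sla)/(flush_quot _ _ d0) => j ltj.
    have [cq _ _ _] := Qq (Ordinal ltj).
    move/(core_flushP m0 (pq _) (sq _)): cq; apply: flush_eq_mem => y.
    by rewrite -memq.
  + apply/(coreP sd0 pX sla cs ssig) => a; rewrite (divn_eq a d).
    have ltj := ltn_pmod a d0; rewrite -!resc_quot //.
    have [_ + _ _] := Qq (Ordinal ltj); rewrite -qE => /core_part; apply=> //.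
    * by rewrite quot_uniq.
    * by rewrite -szq size_quot.
    * exact: fsig.
  + apply/(coreP td0 pX sla ct stau) => a; rewrite (divn_eq a d).
    have ltj := ltn_pmod a d0; rewrite -!resc_quot //.
    have [_ _ + _] := Qq (Ordinal ltj); rewrite -qE => /core_part; apply=> //.
    * by rewrite quot_uniq.
    * by rewrite -szq size_quot -lst.
    * exact: ftau.
  + exact: sla.
Qed.

(** * Adding beads at the bottom *)

Lemma mem_beta_shift n c la x : size la <= n ->
  (x \in beta (n + c) la) = (x < c) || (c <= x) && (x - c \in beta n la).
Proof.
move=> sla; apply/idP/idP => [/mem_beta[i lti ->]|].
  have [ltin|lein] := ltnP i n; last by rewrite nth_default; lia.
  apply/orP; right; apply/andP; split; first by lia.
  by apply/mem_beta; exists i => //; lia.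
have [ltxc _|lecx /= /mem_beta[i ltin e]] := ltnP x c; apply/mem_beta.
  by exists (n + c - x.+1); rewrite ?nth_default; lia.
by exists i; lia.
Qed.

Section Shift.
Variables (n d j N : nat) (la : seq nat).
Hypotheses (pla : is_partition la) (sla : size la <= n) (ltjd : j < d).

Let Q := quot d j (beta n la).
Let Q' := quot d j (beta (n + N * d) la).

(** A shift by [N * d] keeps every bead on its runner and raises it [N] places there. *)
Let memQ' x : (x \in Q') = (x < N) || (N <= x) && (x - N \in Q).
Proof.
rewrite !mem_quot // mem_beta_shift //.
have -> : (x * d + j < N * d) = (x < N) by nia.
have -> : (N * d <= x * d + j) = (N <= x) by nia.
case: (leqP N x) => //= le; have -> : x * d + j - N * d = (x - N) * d + j by rewrite mulnBl addnBAC ?leq_mul.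
by rewrite ?orbT.
Qed.

Lemma resc_shift : resc d j (beta (n + N * d) la) = resc d j (beta n la) + N.
Proof.
have uQ : uniq Q by rewrite quot_uniq ?beta_uniq.
have memI x : (x \in map (addn N) Q) = (N <= x) && (x - N \in Q).
  apply/mapP/andP => [[y yQ ->]|[le xQ]]; first by rewrite leq_addr addKn.
  by exists (x - N) => //; rewrite subnKC.
rewrite -!size_quot -/Q -/Q' -(size_map (addn N) Q) -[X in _ + X](size_iota 0) -size_cat.
apply/perm_size/uniq_perm; first exact: quot_uniq (beta_uniq _ pla).
  rewrite cat_uniq iota_uniq andbT map_inj_uniq ?uQ /=; last exact: addnI.
  by apply/hasPn => x; rewrite mem_iota memI /=; lia.
by move=> x; rewrite memQ' mem_cat mem_iota memI orbC.
Qed.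

Lemma part_shift : part Q' = part Q.
Proof.
have uQ : uniq Q by rewrite quot_uniq ?beta_uniq.
apply: (@part_unique _ _ _ (size Q + N)).
- exact: quot_uniq (beta_uniq _ pla).
- by rewrite !size_quot resc_shift.
- exact: part_partition.
- by rewrite (leq_trans (size_part Q)) ?leq_addr.
by move=> x; rewrite mem_beta_shift ?size_part // memQ' beta_part.
Qed.

End Shift.

(** * The product formula along the progression of lengths *)

Theorem theorem17 (s t : nat) (sigma tau : seq nat) :
  0 < s -> 0 < t ->
  is_core s sigma -> is_core t tau ->
  core (gcdn s t) sigma = core (gcdn s t) tau ->
  forall i : nat, maxn (plen sigma) (plen tau) <= i ->
  exists (sig' tau' : nat -> seq nat) (l : nat -> nat),
    (forall j, j < gcdn s t ->
       is_core (s %/ gcdn s t) (sig' j) /\ is_core (t %/ gcdn s t) (tau' j)) /\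
    forall k : nat,
      Ncount s t sigma tau (i + lcmn s t * k) =
      \prod_(j < gcdn s t)
         Ncount (s %/ gcdn s t) (t %/ gcdn s t) (sig' j) (tau' j)
                (l j + (lcmn s t %/ gcdn s t) * k).
Proof.
move=> s0 t0 cs ct ecore i; rewrite geq_max /plen => /andP[ssig stau].
have d0 : 0 < gcdn s t by rewrite gcdn_gt0 s0.
have [/divnK es /divnK et] := (dvdn_gcdl s t, dvdn_gcdr s t).
have el : lcmn s t = lcmn (s %/ gcdn s t) (t %/ gcdn s t) * gcdn s t.
  by rewrite muln_lcml es et.
have s'0 : 0 < s %/ gcdn s t by rewrite divn_gt0 // dvdn_leq ?dvdn_gcdl.
have t'0 : 0 < t %/ gcdn s t by rewrite divn_gt0 // dvdn_leq ?dvdn_gcdr.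
move: d0 es et el s'0 t'0 ecore.
move: (gcdn s t) => d; move: (s %/ d) (t %/ d) => s' t' d0 es et el s'0 t'0 ecore.
rewrite -{}es in s0 cs el *; rewrite -{}et in t0 ct el *.
have [psig ptau] : is_partition sigma /\ is_partition tau by case: cs; case: ct.
(* Both partitions reduce to the same [d]-core, and the reductions preserve residue counts modulo
   [d]. *)
have lst n j : size sigma <= n -> size tau <= n ->
    resc d j (beta n sigma) = resc d j (beta n tau).
  move=> sn tn; have [c1 _] := core_spec sigma d0; have [c2 _] := core_spec tau d0.
  have [_ _ ->] := removal_chain d0 c1 psig sn.
  by have [_ _ ->] := removal_chain d0 c2 ptau tn; rewrite ecore.
(* The runners at [i] beads, with their bead counts as length bounds. *)
exists (fun j => part (quot d j (beta i sigma))), (fun j => part (quot d j (beta i tau))),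
  (fun j => resc d j (beta i sigma)).
split=> [j ltj|k].
  have /(core_flushP s0 psig ssig)/(flush_quot _ _ d0)/(_ _ ltj) fs := cs.
  have /(core_flushP t0 ptau stau)/(flush_quot _ _ d0)/(_ _ ltj) ft := ct.
  by split; apply: part_core => //; apply/quot_uniq/beta_uniq.
have le n : size tau <= i -> size sigma <= i -> 
   size sigma <= i + n * d /\ size tau <= i + n * d by lia.
(* The [lcmn s' t' * d * k] extra beads put [lcmn s' t' * k] beads at the bottom of each of the [d]
   runners. *)
rewrite el mulnK // mulnAC; have [sn tn] := le (lcmn s' t' * k) stau ssig.
rewrite Ncount_quot //; last by move=> j _; apply: lst.
by apply: eq_bigr => j _; rewrite !part_shift // resc_shift.
Qed.
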